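(* If $k$ is $C_0$-universal, then for any fixed $M>0$ the topology induced by $d_{W^*}$ is finer than the weak-* topology on $\mathcal{V}_{d,M}=\{\mu\in\mathcal{V}_d : |\mu|(\mathbb{R}^n)\le M\}$.
   Context: Let $0\le d\le n$. $\widetilde{G}^n_d$ is the set of oriented $d$-dimensional linear subspaces of $\mathbb{R}^n$, identified with a subset of the unit sphere of $\Lambda^d(\mathbb{R}^n)$ by $T\mapsto \frac{u_1\wedge\cdots\wedge u_d}{|u_1\wedge\cdots\wedge u_d|}$ for any basis $(u_i)$ of $T$ consistent with its orientation (inner product $\langle \xi_1\wedge\cdots\wedge\xi_d,\eta_1\wedge\cdots\wedge\eta_d\rangle=\det(\xi_i\cdot\eta_j)_{i,j}$), with the induced topology. $\mathcal{V}_d$ is the set of oriented $d$-varifolds, i.e. nonnegative finite Radon measures on $\mathbb{R}^n\times\widetilde{G}^n_d$; $|\mu|(A)=\mu(A\times\widetilde{G}^n_d)$ for Borel $A\subset\mathbb{R}^n$; $(\mu|\omega)=\int\omega\,d\mu$. Weak-* convergence $\mu_i\to\mu$ means $(\mu_i|\omega)\to(\mu|\omega)$ for all continuous compactly supported $\omega$ on $\mathbb{R}^n\times\widetilde{G}^n_d$; the weak-* topology is the corresponding (metrizable) topology. Standing assumptions on kernels: $k^{pos}$ and $k^G$ are continuous positive definite kernels on $\mathbb{R}^n$ and $\widetilde{G}^n_d$ respectively, with $k^{pos}(x,\cdot)\in C_0(\mathbb{R}^n)$ for every $x$ ($C_0$: continuous functions vanishing at infinity). $W$ is the reproducing kernel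 Hilbert space (RKHS) of $k((x,T),(x',T'))=k^{pos}(x,x')k^G(T,T')$; it is continuously embedded in $C_0(\mathbb{R}^n\times\widetilde{G}^n_d)$. $d_{W^*}(\mu,\mu')=\|\mu-\mu'\|_{W^*}$ where $\|\mu\|_{W^*}=\sup_{\omega\in W,\|\omega\|_W\le1}|(\mu|\omega)|$. The kernel $k$ is $C_0$-universal if $W$ is dense in $C_0(\mathbb{R}^n\times\widetilde{G}^n_d)$ for uniform convergence. *)

(* Defs.v *)
From HB Require Import structures.
From mathcomp Require Import all_boot all_order all_algebra.
From mathcomp Require Import all_classical all_reals all_analysis.

Set Implicit Arguments.
Unset Strict Implicit.
Unset Printing Implicit Defensive.

Import Order.TTheory GRing.Theory Num.Theory.
Import numFieldTopology.Exports numFieldNormedType.Exports.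

Local Open Scope classical_set_scope.
Local Open Scope ring_scope.

Section FunctionSpaces.
Context {R : realType} {X : topologicalType}.
Implicit Types f : X -> R.

Definition vanishes_at_infinity f :=
  forall e : R, 0 < e ->
    exists2 K : set X, compact K & forall x, ~ K x -> `|f x| < e.

Definition C0 : set (X -> R) :=
  [set f | continuous f /\ vanishes_at_infinity f].

Definition Cc : set (X -> R) :=
  [set f | continuous f /\ compact (closure [set x | f x != 0])].

End FunctionSpaces.
Arguments C0 : clear implicits.
Arguments Cc : clear implicits.

Section Kernels.
Context {R : realType}.

(* As usual for reproducing kernels, "positive definite" is the non-strict
   condition. *)
Definition positive_definite_kernel (X : Type) (k : X -> X -> R) :=
  (forall x y, k x y = k y x) /\
  (forall (m : nat) (x : 'I_m -> X) (c : 'I_m -> R),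
     0 <= \sum_(i < m) \sum_(j < m) c i * c j * k (x i) (x j)).

Definition continuous_kernel (X : topologicalType) (k : X -> X -> R) :=
  continuous (fun p : X * X => k p.1 p.2).

Definition product_kernel (X Y : Type) (kX : X -> X -> R) (kY : Y -> Y -> R)
    (p q : X * Y) : R :=
  kX p.1 q.1 * kY p.2 q.2.

(* A Hilbert space of functions on X in which every k x is a member and
   represents evaluation at x. Given k it is unique, inner product included
   (on members; off the carrier the value of rkhs_ip is irrelevant). *)
Record rkhs (X : Type) (k : X -> X -> R) := Rkhs {
  rkhs_fun : set (X -> R) ;
  rkhs_ip : (X -> R) -> (X -> R) -> R ;
  rkhs_zero : rkhs_fun (fun=> 0) ;
  rkhs_lin : forall (a : R) f g,
    rkhs_fun f -> rkhs_fun g -> rkhs_fun (fun x => a * f x + g x) ;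
  rkhs_ipC : forall f g,
    rkhs_fun f -> rkhs_fun g -> rkhs_ip f g = rkhs_ip g f ;
  rkhs_ip_lin : forall (a : R) f g h,
    rkhs_fun f -> rkhs_fun g -> rkhs_fun h ->
    rkhs_ip (fun x => a * f x + g x) h = a * rkhs_ip f h + rkhs_ip g h ;
  rkhs_ip_gt0 : forall f, rkhs_fun f -> f <> (fun=> 0) -> 0 < rkhs_ip f f ;
  rkhs_complete : forall u : nat -> X -> R,
    (forall i, rkhs_fun (u i)) ->
    (forall e : R, 0 < e -> exists N : nat, forall i j,
       (N <= i)%N -> (N <= j)%N ->
       Num.sqrt (rkhs_ip (u i \- u j) (u i \- u j)) < e) ->
    exists2 f, rkhs_fun f &
      Num.sqrt (rkhs_ip (u i \- f) (u i \- f)) @[i --> \oo] --> (0 : R) ;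
  rkhs_kernel : forall x, rkhs_fun (k x) ;
  rkhs_reproducing : forall f x, rkhs_fun f -> rkhs_ip f (k x) = f x
}.

Definition rkhs_norm (X : Type) (k : X -> X -> R) (W : rkhs k) (f : X -> R) : R :=
  Num.sqrt (rkhs_ip W f f).

Definition continuously_embedded_C0 (X : topologicalType) (k : X -> X -> R)
    (W : rkhs k) :=
  rkhs_fun W `<=` C0 R X /\
  exists C : R, forall f, rkhs_fun W f -> forall x, `|f x| <= C * rkhs_norm W f.

Definition C0_universal (X : topologicalType) (k : X -> X -> R)
    (W : rkhs k) :=
  rkhs_fun W `<=` C0 R X /\
  forall g, C0 R X g -> forall e : R, 0 < e ->
    exists2 f, rkhs_fun W f & forall x, `|f x - g x| < e.

End Kernels.

Definition borel (X : ptopologicalType) := g_sigma_algebraType (@open X).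

Section RadonMeasures.
Context (R : realType) (X : ptopologicalType).

Definition inner_regular (mu : set (borel X) -> \bar R) :=
  forall A : set (borel X), measurable A ->
    mu A = ereal_sup [set mu K | K in
      [set K : set (borel X) | compact (K : set X) /\ K `<=` A]].

Record radon_measure := RadonMeasure {
  radon_val :> {finite_measure set (borel X) -> \bar R} ;
  radon_regular : inner_regular radon_val
}.

HB.instance Definition _ := gen_eqMixin radon_measure.
HB.instance Definition _ := gen_choiceMixin radon_measure.

Definition pairing (mu : radon_measure) (w : X -> R) : R :=
  (\int[mu]_p w p)%R.

(* The coarsest topology for which mu |-> pairing mu w is continuous for
   every w in Cc. *)
Definition weak_star : Type :=
  initial_topology
    ((fun mu w => pairing mu (set_val w))
       : radon_measure -> {ptws (Cc R X : Type) -> R}).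

HB.instance Definition _ := Topological.on weak_star.

(* Extended-real valued, so that the supremum is meaningful even when it is
   not known to be finite. *)
Definition dual_norm (k : X -> X -> R) (W : rkhs k) (L : (X -> R) -> R) : \bar R :=
  ereal_sup [set (`|L w|)%:E |
    w in [set w | rkhs_fun W w /\ rkhs_norm W w <= 1]].

Definition dual_dist (k : X -> X -> R) (W : rkhs k) (mu nu : radon_measure) :
    \bar R :=
  dual_norm W (fun w => pairing mu w - pairing nu w).

End RadonMeasures.

(* A `&` U is open in A for the topology of the (pseudo)distance D restricted
   to A. *)
Definition dist_open_in (R : realType) (T : Type) (D : T -> T -> \bar R)
    (A U : set T) :=
  forall x, A x -> U x ->
    exists2 e : R, 0 < e & forall y, A y -> (D x y < e%:E)%E -> U y.

Section OrientedGrassmannian.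
Context (R : realType) (n d : nat).

Definition increasing_map : Type :=
  {f : {ffun 'I_d -> 'I_n} |
    [forall i : 'I_d, forall j : 'I_d, (i < j)%N ==> (f i < f j)%N]}.

HB.instance Definition _ := Finite.on increasing_map.

(* Coordinates on the d-th exterior power of R^n in the orthonormal basis
   e_(i1) /\ ... /\ e_(id), i1 < ... < id. *)
Definition ext_power : Type := 'rV[R]_#|{: increasing_map}|.

HB.instance Definition _ := Topological.on ext_power.

(* The rows of U are u_1, ..., u_d; the coordinates of their wedge product are
   the maximal minors of U. *)
Definition wedge (U : 'M[R]_(d, n)) : ext_power :=
  \row_k \det (colsub (val (enum_val k : increasing_map)) U).

(* |u_1 /\ ... /\ u_d|, from the Gram determinant inner product. *)
Definition wedge_norm (U : 'M[R]_(d, n)) : R := Num.sqrt (\det (U *m U^T)).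

(* An oriented subspace is presented by a basis U of it and a sign s telling
   whether U is positively oriented. For d > 0 the sign is redundant (negate a
   basis vector); it is needed for the two orientations of {0} when d = 0. *)
Definition oriented_grassmannian : set ext_power :=
  [set xi | exists (U : 'M[R]_(d, n)) (s : bool), row_free U /\
     xi = (-1) ^+ s *: ((wedge_norm U)^-1 *: wedge U : 'rV[R]_ _)].

End OrientedGrassmannian.
Arguments oriented_grassmannian : clear implicits.

Lemma oriented_grassmannian_inhabited (R : realType) (n d : nat) :
  (d <= n)%N -> exists xi, oriented_grassmannian R n d xi.
Proof.
move=> dn; eexists; exists (pid_mx d), false; split; last reflexivity.
by rewrite /row_free rank_pid_mx.
Qed.

(* The proof of d <= n is an argument because the library's measurable spaces
   are inhabited types. *)
Definition oGr (R : realType) (n d : nat) (dn : (d <= n)%N) : Type :=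
  set_type (oriented_grassmannian R n d).

HB.instance Definition _ (R : realType) (n d : nat) (dn : (d <= n)%N) :=
  Topological.on (oGr R dn).

HB.instance Definition _ (R : realType) (n d : nat) (dn : (d <= n)%N) :=
  isPointed.Build (oGr R dn)
    (SigSub (mem_set (projT2 (cid (oriented_grassmannian_inhabited R dn))))).

HB.instance Definition _ (X Y : ptopologicalType) := Pointed.on (X * Y)%type.

Definition varifold (R : realType) (n d : nat) (dn : (d <= n)%N) : Type :=
  radon_measure R ('rV[R]_n * oGr R dn)%type.

Definition weight (R : realType) (n d : nat) (dn : (d <= n)%N)
    (mu : varifold R dn) (A : set 'rV[R]_n) : \bar R :=
  mu (A `*` setT).

Definition varifolds_le (R : realType) (n d : nat) (dn : (d <= n)%N) (M : R) :
    set (varifold R dn) :=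
  [set mu | (weight mu setT <= M%:E)%E].
Arguments varifolds_le {R n d} dn M.

(* Main.v *)
(* A test function w in Cc is uniformly close to some f in W by universality.
   On measures of mass at most M the error made by replacing w by f is at most
   M times the uniform distance, while |(mu|f) - (nu|f)| is at most
   (1 + ||f||) d(mu, nu). Hence mu |-> (mu|w) is continuous for d on the ball of
   mass M. *)

Require Import Defs.
From HB Require Import structures.
From mathcomp Require Import all_boot all_order all_algebra.
From mathcomp Require Import all_classical all_reals all_analysis.

From mathcomp Require Import lra.

Import Order.TTheory GRing.Theory Num.Theory.
Import numFieldTopology.Exports numFieldNormedType.Exports.

Local Open Scope classical_set_scope.
Local Open Scope ring_scope.

Lemma Cc_C0 (R : realType) (X : topologicalType) : Cc R X `<=` C0 R X.
Proof.
move=> w [cw Kw]; split=> // e e0.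
exists (closure [set x | w x != 0]) => // x nKx.
have [->|wx0] := eqVneq (w x) 0; first by rewrite normr0.
by exfalso; apply: nKx; apply: subset_closure.
Qed.

Lemma continuous_borel_measurable (R : realType) (X : ptopologicalType)
  (f : X -> R) : continuous f -> measurable_fun (setT : set (borel X)) f.
Proof.
move=> /continuousP cf.
apply: (measurability _ (measurable_realfun.RGenOpens.measurableE R)).
move=> _ [_ [a [b ->] <-]]; rewrite setTI.
by apply: sub_sigma_algebra; apply: cf; exact: interval_open.
Qed.

Section Pairing.
Context {R : realType} {X : ptopologicalType}.
Implicit Types (mu : radon_measure R X) (f g : X -> R).

Lemma continuous_bounded_integrable mu {f} {C : R} :
  continuous f -> (forall x, `|f x| <= C) ->
  mu.-integrable setT (EFin \o f : borel X -> \bar R).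
Proof.
move=> cf fC; apply: measurable_bounded_integrable => //.
- by rewrite ltey_eq fin_num_measure.
- exact: continuous_borel_measurable.
- exists C; split; first exact: num_real.
  by move=> D CD x _; apply: le_trans (fC x) (ltW CD).
Qed.

(** Integrate the pointwise bound [e] on [|f - g|] against a measure of mass at most [M]. The bound
    [C] serves integrability: together with [e] it also bounds [g], so the two integrals can be
    subtracted. *)
Lemma pairing_dist_le {mu f g} {C e M : R} :
  continuous f -> continuous g -> (forall x, `|f x| <= C) ->
  (forall x, `|f x - g x| <= e) -> 0 <= e -> (mu setT <= M%:E)%E ->
  `|pairing mu f - pairing mu g| <= e * M.
Proof.
move=> cf cg fC fge e0 muM.
have gC x : `|g x| <= C + e.
  rewrite -[g x](subKr (f x)) (le_trans (ler_normB _ _))//.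
  by rewrite lerD// -opprB normrN.
have If := continuous_bounded_integrable mu cf fC.
have Ig := continuous_bounded_integrable mu cg gC.
rewrite /pairing -RintegralB//.
have cfg : continuous (fun x => f x - g x).
  by move=> x; apply: cvgB; [exact: cf|exact: cg].
have Ifg := continuous_bounded_integrable mu cfg fge.
have Inorm : mu.-integrable setT
    (EFin \o (fun x => `|f x - g x|) : borel X -> \bar R).
  apply: (@continuous_bounded_integrable mu _ e) => [x|x];
    last by rewrite normr_id.
  by apply: cvg_norm; exact: cfg.
have Icst : mu.-integrable setT (EFin \o (fun=> e) : borel X -> \bar R).
  apply: (@continuous_bounded_integrable mu _ `|e|) => // x; exact: cvg_cst.
apply: le_trans (le_normr_Rintegral _ Ifg) _ => //.
apply: (le_trans (le_Rintegral measurableT Inorm Icst _)) => [x _ //|].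
rewrite Rintegral_cst//; apply: ler_wpM2l => //.
by rewrite -lee_fin fineK// fin_num_measure.
Qed.

End Pairing.

Section DualNorm.
Context {R : realType} {X : ptopologicalType} {k : X -> X -> R} {W : rkhs k}.

Lemma rkhs_scale (a : R) {f} : rkhs_fun W f -> rkhs_fun W (fun x => a * f x).
Proof.
move=> Wf; have := rkhs_lin a Wf (rkhs_zero W).
by under eq_fun do rewrite addr0.
Qed.

Lemma rkhs_ip_scale (a : R) {f g} : rkhs_fun W f -> rkhs_fun W g ->
  rkhs_ip W (fun x => a * f x) g = a * rkhs_ip W f g.
Proof.
move=> Wf Wg; have W0 := rkhs_zero W.
(* Linearity at [1 * 0 + 0] shows that the inner product of zero with [g] equals its own double,
   hence vanishes. This disposes of the second summand in [a * f + 0]. *)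
have := rkhs_ip_lin 1 W0 W0 Wg; under eq_fun do rewrite mulr0 addr0.
move/eqP; rewrite mul1r -subr_eq subrr => /eqP ip0.
have := rkhs_ip_lin a Wf W0 Wg; under eq_fun do rewrite addr0.
by rewrite -ip0 addr0.
Qed.

Lemma rkhs_norm_scale (a : R) {f} : rkhs_fun W f ->
  rkhs_norm W (fun x => a * f x) = `|a| * rkhs_norm W f.
Proof.
move=> Wf; have Waf := rkhs_scale a Wf.
rewrite /rkhs_norm rkhs_ip_scale// rkhs_ipC// rkhs_ip_scale// mulrA -expr2.
by rewrite sqrtrM ?sqr_ge0// sqrtr_sqr.
Qed.

(** Dividing [f] by 1 plus its norm puts it in the unit ball of [W], where the supremum controls
    [L]; homogeneity along [f] carries the bound back. The added 1 keeps the divisor positive even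
    when [f] has norm zero. *)
Lemma dual_norm_bound {L : (X -> R) -> R} {f} {e : R} :
  rkhs_fun W f -> (forall a, L (fun x => a * f x) = a * L f) ->
  (dual_norm W L < e%:E)%E -> `|L f| <= (1 + rkhs_norm W f) * e.
Proof.
move=> Wf Lf Le; pose c := 1 + rkhs_norm W f.
have c0 : 0 < c by rewrite ltr_pwDl// sqrtr_ge0.
rewrite -(ler_pdivrMl _ _ c0) -(gtr0_norm c0) -normfV -normrM -Lf -lee_fin.
apply: le_trans (ltW Le); apply: ereal_sup_ubound.
exists (fun x => c^-1 * f x) => //; split; first exact: rkhs_scale.
rewrite rkhs_norm_scale// normfV gtr0_norm// ler_pdivrMl// mulr1.
by rewrite /c lerDr.
Qed.

End DualNorm.

Section WeakStar.
Context {R : realType} {X : ptopologicalType} {k : X -> X -> R} {W : rkhs k}.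

(** Going from [pairing mu w] to [pairing nu w] through [pairing mu f] and [pairing nu f] costs
    three errors of at most [e / 4] each. Quarters are used because these bounds are not strict
    while the conclusion is. *)
Lemma pairing_dual_dist_close {M : R} {mu : radon_measure R X} {w : X -> R} :
  0 < M -> continuously_embedded_C0 W -> C0_universal W -> C0 R X w ->
  (mu setT <= M%:E)%E -> forall e : R, 0 < e ->
  exists2 t : R, 0 < t & forall nu : radon_measure R X,
    (nu setT <= M%:E)%E -> (dual_dist W mu nu < t%:E)%E ->
    `|pairing mu w - pairing nu w| < e.
Proof.
move=> M0 [WC0 [C fC]] [_ dense] C0w muM e e0.
(* With this accuracy, replacing [w] by [f] costs at most [s * M = e / 4]. *)
pose s := e / 4 / M.
have s0 : 0 < s by rewrite !divr_gt0.
have [f Wf fw] := dense _ C0w _ s0.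
have [cf _] := WC0 _ Wf; have [cw _] := C0w.
have c0 : 0 < 1 + rkhs_norm W f by rewrite ltr_pwDl// sqrtr_ge0.
(* The radius at which [dual_norm_bound] yields exactly [e / 4]; it is fixed before [nu] is
   given. *)
exists (e / 4 / (1 + rkhs_norm W f)); first by rewrite !divr_gt0.
move=> nu nuM D.
have close (m : radon_measure R X) : (m setT <= M%:E)%E ->
    `|pairing m f - pairing m w| <= e / 4.
  move=> mM; rewrite -[e / 4](divfK (lt0r_neq0 M0)).
  apply: (@pairing_dist_le _ _ _ _ _ (C * rkhs_norm W f)) => //.
  - exact: fC.
  - by move=> x; rewrite ltW.
  - exact: ltW.
have pairingZ (m : radon_measure R X) a :
    pairing m (fun x => a * f x) = a * pairing m f.
  apply: RintegralZl => //.
  exact: continuous_bounded_integrable _ cf (fC _ Wf).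
have mid : `|pairing mu f - pairing nu f| <= e / 4.
  rewrite -[e / 4](divfK (lt0r_neq0 c0)) mulrC.
  by apply: dual_norm_bound D => // a; rewrite !pairingZ mulrBr.
have := close _ muM; have := close _ nuM; move: mid.
rewrite !ler_norml; move=> /andP[? ?] /andP[? ?] /andP[? ?].
by rewrite ltr_norml; apply/andP; split; lra.
Qed.

(** An open set of the initial topology is the preimage of some open [V] under the evaluation map.
    It is thus enough that evaluation converges along the filter of dual-distance balls around [mu],
    cut down to mass at most [M]. *)
Lemma weak_star_dist_open {M : R} {U : set (weak_star R X)} :
  0 < M -> continuously_embedded_C0 W -> C0_universal W -> open U ->
  dist_open_in (dual_dist W) [set mu | (mu setT <= M%:E)%E] U.
Proof.
move=> M0 WC0 univ [V oV <-] mu /= muM Vmu.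
pose A := [set nu : radon_measure R X | (nu setT <= M%:E)%E].
pose F := filter_from [set e : R | 0 < e]
  (fun e => A `&` [set nu | (dual_dist W mu nu < e%:E)%E]).
have FF : Filter F.
  apply: filter_from_filter; first by exists 1 => /=.
  move=> a b /= a0 b0; exists (Num.min a b) => [/=|nu [Anu /= Dnu]].
    by rewrite lt_min a0.
  by split; split=> //=; apply: lt_le_trans Dnu _;
    rewrite lee_fin ge_min lexx ?orbT.
pose ev (nu : radon_measure R X) : {ptws (Cc R X : Type) -> R} :=
  fun w => pairing nu (set_val w).
have cvF : ev @ F --> ev mu.
  (* The pointwise topology is a supremum over test functions, so one [w] is treated at a time.
     Passing to values at [w] requires that evaluation at [w] be onto, which constant functions
     show. *)
  apply/cvg_sup => w; apply/cvg_image.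
    by rewrite eqEsubset; split=> // r _; exists (cst r).
  suff cvw : (fun nu => ev nu w) @ F --> ev mu w.
    move=> B /cvw FB; exists ((fun g : Cc R X -> R => g w) @^-1` B) => //.
    by rewrite image_preimage// eqEsubset; split=> // r _; exists (cst r).
  apply/cvgrPdist_lt => e e0.
  have C0w : C0 R X (set_val w) by apply: Cc_C0; exact: set_valP.
  have [t t0 tP] := pairing_dual_dist_close M0 WC0 univ C0w muM _ e0.
  by exists t => // nu [Anu Dnu]; exact: tP.
have [e e0 eV] : F (ev @^-1` V) by apply: cvF; exact: open_nbhs_nbhs.
by exists e => // nu Anu Dnu; apply: eV.
Qed.

End WeakStar.

Theorem proposition3p10 (R : realType) (n d : nat) (dn : (d <= n)%N)
    (kpos : 'rV[R]_n -> 'rV[R]_n -> R) (kG : oGr R dn -> oGr R dn -> R)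
    (kpos_cont : continuous_kernel kpos)
    (kpos_pd : positive_definite_kernel kpos)
    (kpos_C0 : forall x, C0 R 'rV[R]_n (kpos x))
    (kG_cont : continuous_kernel kG)
    (kG_pd : positive_definite_kernel kG)
    (W : rkhs (product_kernel kpos kG))
    (W_C0 : continuously_embedded_C0 W)
    (k_univ : C0_universal W)
    (M : R) (M_gt0 : 0 < M) :
  forall U : set (weak_star R ('rV[R]_n * oGr R dn)%type),
    open U -> dist_open_in (dual_dist W) (varifolds_le dn M) U.
Proof.
move=> U oU; rewrite /varifolds_le /weight.
(* The weight of the whole space is the total mass of the varifold. *)
under [in X in dist_open_in _ X _]eq_set do rewrite setXTT.
exact: weak_star_dist_open M_gt0 W_C0 k_univ oU.
Qed.
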